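(* (i) Let $(S,s)$ be an involutive solution of the Pentagon Equation (PE) on a non-empty set $S$. Then there exist elementary abelian $2$-groups $(A,+)$ and $(G,\cdot)$, a non-empty set $X$ and a map $\sigma\colon A\to\operatorname{Sym}(X)$ (not necessarily a group morphism) such that $S$ may be identified (via a bijection) with $X\times A\times G$ and, under this identification, \[s((x,a,g),(y,b,h))=((x,a,g\cdot h),(\sigma_{a+b}\sigma_b^{-1}(y),a+b,h))\] for all $x,y\in X$, $a,b\in A$ and $g,h\in G$. (ii) Under the correspondence in (i), the involutive solutions of the PE defined on a given non-empty set $S$, up to isomorphism, are in bijective correspondence with decompositions of $S$ as a product $X\times A\times G$, where $X$ is a non-empty set and $A,G$ are elementary abelian $2$-groups. Here decompositions are considered up to the cardinalities of the factors; that is: for every such decomposition and every map $\sigma\colon A\to \operatorname{Sym}(X)$ the formula in (i) defines an involutive solution, every involutive solution on $S$ arises in this way, and two solutions arising from $(X_1,A_1,G_1,\sigma_1)$ and $(X_2,A_2,G_2,\sigma_2)$ are isomorphic if and only if $|X_1|=|X_2|$, $|A_1|=|A_2|$ and $|G_1|=|G_2|$. (iii) In particular, if $S$ is finite of cardinality $|S|=2^n(2m+1)$ for some integers $n,m\geq 0$, then there exist, up to isomorphism, exactly $\binom{n+2}{2}$ involutive solutions of the PE defined on $S$.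
   Context: A (set-theoretic) solution of the Pentagon Equation (PE) is a pair $(S,s)$ where $S$ is a non-empty set and $s\colon S\times S\to S\times S$ is a map with $s_{23}s_{13}s_{12}=s_{12}s_{23}$ on $S^3$, where $s_{ij}$ acts as $s$ on the $i$-th and $j$-th components and as the identity on the remaining one (so $s_{12}=s\times\mathrm{id}$, $s_{23}=\mathrm{id}\times s$, $s_{13}=(\tau\times\mathrm{id})(\mathrm{id}\times s)(\tau\times\mathrm{id})$ with $\tau(x,y)=(y,x)$). It is involutive if $s^2=\mathrm{id}$. Two solutions $(S,s)$ and $(S',s')$ are isomorphic if there is a bijection $f\colon S\to S'$ with $(f\times f)s=s'(f\times f)$. For a set $X$, $\operatorname{Sym}(X)$ is the group of all permutations of $X$; for $\sigma\colon A\to\operatorname{Sym}(X)$ write $\sigma_a=\sigma(a)$. An elementary abelian $2$-group is an abelian group in which the square (double, in additive notation) of every element is trivial; the trivial group is allowed. *)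

(* Defs.v *)
From HB Require Import structures.
From mathcomp Require Export all_boot all_algebra.
From mathcomp Require Export all_classical.

Set Implicit Arguments.
Unset Strict Implicit.
Unset Printing Implicit Defensive.

Local Open Scope classical_set_scope.
Local Open Scope card_scope.
Local Open Scope ring_scope.

Definition cross {T U T' U' : Type} (f : T -> T') (g : U -> U') (p : T * U) :
  T' * U' := (f p.1, g p.2).

(* Elements of S^3 are left-nested triples ((x, y), z). *)
Definition s12 {S : Type} (s : S * S -> S * S) : S * S * S -> S * S * S :=
  cross s id.

Definition s23 {S : Type} (s : S * S -> S * S) (t : S * S * S) : S * S * S :=
  let: (x, y, z) := t in let: (y', z') := s (y, z) in (x, y', z').

Definition s13 {S : Type} (s : S * S -> S * S) : S * S * S -> S * S * S :=
  cross swap_pair id \o s23 s \o cross swap_pair id.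

Definition pentagon_equation {S : Type} (s : S * S -> S * S) : Prop :=
  s23 s \o s13 s \o s12 s =1 s12 s \o s23 s.

Definition involutive_solution {S : Type} (s : S * S -> S * S) : Prop :=
  pentagon_equation s /\ involutive s.

Definition isomorphic {S S' : Type} (s : S * S -> S * S)
    (s' : S' * S' -> S' * S') : Prop :=
  exists f : S -> S', bijective f /\ cross f f \o s =1 s' \o cross f f.

(* A permutation carries its two-sided inverse, written ^-1 as in functions.v;
   X may be infinite. *)
Notation Sym X := {splitbij [set: X] >-> [set: X]}.

Definition elementary_abelian2_add (A : zmodType) : Prop :=
  forall a : A, a + a = 0.

Definition elementary_abelian2_mul (G : groupType) : Prop :=
  (forall g h : G, commute g h) /\ (forall g : G, g * g = 1)%g.

Definition model_solution {X : Type} {A : zmodType} {G : groupType}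
    (sigma : A -> Sym X) (p : (X * A * G) * (X * A * G)) :
    (X * A * G) * (X * A * G) :=
  let: ((x, a, g), (y, b, h)) := p in
  ((x, a, (g * h)%g), (sigma (a + b) ((sigma b)^-1%FUN y), a + b, h)).

Record decomposition (S : Type) := Decomposition {
  dec_X : Type;
  dec_A : zmodType;
  dec_G : groupType;
  dec_X_nonempty : inhabited dec_X;
  dec_A_elementary : elementary_abelian2_add dec_A;
  dec_G_elementary : elementary_abelian2_mul dec_G;
  dec_bij : {splitbij [set: dec_X * dec_A * dec_G] >-> [set: S]}
}.

(* The model solution transported to S along the identification dec_bij. *)
Definition solution_of {S : Type} (d : decomposition S)
    (sigma : dec_A d -> Sym (dec_X d)) : S * S -> S * S :=
  cross (dec_bij d) (dec_bij d) \o model_solution sigma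
    \o cross (dec_bij d)^-1%FUN (dec_bij d)^-1%FUN.

Definition same_cardinalities {S : Type} (d1 d2 : decomposition S) : Prop :=
  [/\ [set: dec_X d1] #= [set: dec_X d2],
      [set: dec_A d1] #= [set: dec_A d2]
    & [set: dec_G d1] #= [set: dec_G d2]].

Definition iso_class {S : Type} (s : S * S -> S * S) : set (S * S -> S * S) :=
  [set t | involutive_solution t /\ isomorphic s t].

Definition iso_classes (S : Type) : set (set (S * S -> S * S)) :=
  [set iso_class s | s in [set s : S * S -> S * S | involutive_solution s]].
Arguments iso_classes : clear implicits.

Definition arises_from {S : Type} (C : set (S * S -> S * S))
    (d : decomposition S) : Prop :=
  exists sigma : dec_A d -> Sym (dec_X d), C (solution_of sigma).

(* Being in the relation arises_from is a bijection between the isomorphism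
   classes and the decompositions modulo same_cardinalities: the first clause
   maps each class C to one equivalence class of decompositions, the second
   makes this map injective and surjective.  Equivalence classes of
   decompositions are not formed as elements of a [set], because the universe
   of decomposition S is too large for [set]. *)
Definition classes_biject_with_decompositions (S : Type) : Prop :=
  (forall C, iso_classes S C ->
     exists d : decomposition S,
       forall d', arises_from C d' <-> same_cardinalities d d')
  /\ (forall d : decomposition S, exists! C, iso_classes S C /\ arises_from C d).

(* Main.v *)
Require Import Defs.
From HB Require Import structures.
From mathcomp Require Import zify.

Local Open Scope classical_set_scope.
Local Open Scope card_scope.
Local Open Scope ring_scope.

Set Implicit Arguments.
Unset Strict Implicit.
Unset Printing Implicit Defensive.
Import GRing.Theory.

(* Write s(x, y) = (x ∙ y, theta_x y).  An involutive solution also satisfies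
   the reversed pentagon equation, and together the two give that the theta_x
   are commuting involutions with theta_(x ∙ y) = theta_x and
   theta_(theta_x y) = theta_x theta_y, and that the right multiplications are
   commuting involutions, unchanged when the factor y is replaced by theta_x y.
   So two elementary abelian 2-groups, A of the maps theta_x and G of the right
   multiplications, act freely on S with commuting actions; each point is
   determined by the elements of A and G that it induces and by its translate X
   inducing the identity of both.  This gives the model with sigma trivial, and
   conjugating by sigma shows that every sigma gives an isomorphic model.

   The cardinalities are invariants because A, G and X can be read off from s.
   Conversely elementary abelian 2-groups of the same cardinality are
   isomorphic: a group with a basis of n elements has 2 ^ n elements, and by
   Hessenberg's theorem one with an infinite basis has the cardinality of its
   basis.  When |S| = 2 ^ n (2 m + 1), the classes are thus the pairs of
   exponents |A| = 2 ^ i and |G| = 2 ^ j with i + j <= n. *)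

(** * Cardinal arithmetic *)

Lemma card_leTP T U : [set: T] #<= [set: U] <-> exists f : T -> U, injective f.
Proof.
split=> [/card_leP[f]|[f finj]].
  exists (val \o f \o to_setT) => x y /val_inj/inj.
  by rewrite !in_setE => /(_ I I) /(congr1 val).
apply/card_leP/injfunPex; exists (to_setT \o f \o val) => // x y _ _.
by move=> /(congr1 val)/finj/val_inj.
Qed.

Lemma card_eqTP T U : [set: T] #= [set: U] <-> exists f : T -> U, bijective f.
Proof.
have valK V (x : [set: V]) : to_setT (val x) = x by exact: val_inj.
split=> [/card_bijP[f [g fK gK]]|[f [g fK gK]]].
  exists (val \o f \o to_setT), (val \o g \o to_setT) => x /=.
    by rewrite valK fK.
  by rewrite valK gK.
apply/card_bijP; exists (to_setT \o f \o val), (to_setT \o g \o val) => x.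
  by rewrite /= fK valK.
by rewrite /= gK valK.
Qed.

(** The inhabitant turns [U] into a pointed type, which supplies values outside [A] for a total
    function. *)
Lemma card_eq_set_bij T U (A : set T) (B : set U) : inhabited U -> A #= B ->
  exists f : T -> U, set_bij A B f.
Proof.
move=> [u]; pose U' : pointedType :=
  HB.pack U (gen_eqMixin U) (gen_choiceMixin U) (isPointed.Build U u).
exact: (elimT (@card_set_bijP T U' A B)).
Qed.

Lemma card_finType (T : finType) : [set: T] #= `I_#|T|.
Proof.
rewrite (card_eqr card_II); apply/card_eqTP; exists enum_rank.
exact: enum_rank_bij.
Qed.

(** * Comparability of cardinals by Zorn's lemma *)

Definition injects T U (A : set T) (B : set U) :=
  exists f : T -> U, {in A &, injective f} /\ {homo f : x / A x >-> B x}.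

(** Partial maps are encoded as graphs, so that extension is inclusion and a chain has its union as
    upper bound. *)
Definition partial_injection T U (A : set T) (B : set U) (R : set (T * U)) :=
  [/\ R `<=` A `*` B,
      forall x y y', R (x, y) -> R (x, y') -> y = y'
    & forall x x' y, R (x, y) -> R (x', y) -> x = x'].

Lemma total_on_bigcup2 T (F : set (set T)) x y : total_on F subset ->
  (\bigcup_(X in F) X) x -> (\bigcup_(X in F) X) y ->
  exists X, [/\ F X, X x & X y].
Proof.
move=> Ftot [X FX Xx] [Y FY Yy]; have [XY|YX] := Ftot _ _ FX FY.
  by exists Y; split=> //; exact: XY.
by exists X; split=> //; exact: YX.
Qed.

(** Functionality and injectivity each concern only two pairs of the graph, and two pairs of the
    union of a chain lie in a common member. *)
Lemma partial_injection_bigcup T U (A : set T) (B : set U) F :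
  F `<=` partial_injection A B -> total_on F subset ->
  partial_injection A B (\bigcup_(R in F) R).
Proof.
move=> FP Ftot; split.
- by apply: bigcup_sub => R /FP[].
- move=> x y y' Fxy Fxy'.
  have [R [/FP[_ Rf _] Rxy Rxy']] := total_on_bigcup2 Ftot Fxy Fxy'.
  exact: Rf Rxy Rxy'.
- move=> x x' y Fxy Fxy'.
  have [R [/FP[_ _ Ri] Rxy Rxy']] := total_on_bigcup2 Ftot Fxy Fxy'.
  exact: Ri Rxy Rxy'.
Qed.

Lemma partial_injection_fun T U (A : set T) (B : set U) R : inhabited U ->
  partial_injection A B R -> (forall x, A x -> exists y, R (x, y)) ->
  exists f : T -> U, [/\ {in A &, injective f}, {homo f : x / A x >-> B x}
    & forall x, A x -> R (x, f x)].
Proof.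
move=> [u] [RAB Rf Ri] Rtot.
have /choice[f fP] : forall x, exists y, A x -> R (x, y).
  move=> x; have [Ax|nAx] := pselect (A x); last by exists u.
  by have [y Rxy] := Rtot _ Ax; exists y.
exists f; split=> // [x x' /set_mem /fP Rx /set_mem /fP Rx' ff'|x /fP /RAB[]//].
by rewrite ff' in Rx; exact: Ri Rx Rx'.
Qed.

(** A maximal partial injection is total on [A] or onto [B]: otherwise a pair of two missed points
    could be added. In the second case its converse is total on [B]. *)
Lemma injects_total T U (A : set T) (B : set U) :
  inhabited T -> inhabited U -> injects A B \/ injects B A.
Proof.
move=> iT iU.
have [R [PR Rmax]] := Zorn_bigcup (@partial_injection_bigcup _ _ A B).
have [RAB Rf Ri] := PR.
have [domR|] := pselect (forall x, A x -> exists y, R (x, y)).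
  by left; have [f []] := partial_injection_fun iU PR domR; exists f.
move=> /existsNP[a /not_implyP[Aa /forallNP na]].
have PR' : partial_injection B A [set p | R (p.2, p.1)].
  split=> [[y x] /RAB[]//|y x x'|y y' x] /=; [exact: Ri|exact: Rf].
right; have [|f []] := partial_injection_fun iT PR'; last by exists f.
move=> b Bb; apply: contrapT => /forallNP /= nb.
apply: (Rmax (R `|` [set (a, b)])).
  split; first by move=> p; left.
  by move=> /(_ (a, b) (or_intror erefl)) Rab; apply: na Rab.
split.
- by move=> _ [/RAB//|->].
- move=> x y y' [Rxy|[xa yb]] [Rxy'|[xa' yb']].
  + exact: Rf Rxy Rxy'.
  + by rewrite xa' in Rxy; case: (na _ Rxy).
  + by rewrite xa in Rxy'; case: (na _ Rxy').
  + by rewrite yb.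
- move=> x x' y [Rxy|[xa yb]] [Rxy'|[xa' yb']].
  + exact: Ri Rxy Rxy'.
  + by rewrite yb' in Rxy; case: (nb _ Rxy).
  + by rewrite yb in Rxy'; case: (nb _ Rxy').
  + by rewrite xa.
Qed.

(* A graph of an injection from the square of a set [D] to [D] determines [D]
   through the pairs [(x, x)], so that Zorn's lemma applies to bare graphs. *)
Definition square_dom T (R : set (T * T * T)) : set T :=
  [set x | exists z, R (x, x, z)].

Definition square_injection T (R : set (T * T * T)) :=
  let D := square_dom R in
  [/\ partial_injection (D `*` D) D R
    & forall x y, D x -> D y -> exists z, R (x, y, z)].

Lemma square_injection_bigcup T F :
  F `<=` @square_injection T -> total_on F subset ->
  square_injection (\bigcup_(R in F) R).
Proof.
move=> FP Ftot; set U := \bigcup_(R in F) R.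
have sD R : F R -> square_dom R `<=` square_dom U.
  by move=> FR x [z Rz]; exists z, R.
split.
  split.
  - move=> [[x y] z] [R FR Rxyz].
    have [[RD _ _] _] := FP _ FR; have [/= [Dx Dy] Dz] := RD _ Rxyz.
    by split; [split|]; exact: (sD _ FR).
  - move=> p z z' Uz Uz'.
    have [R [/FP[[_ Rf _] _] Rz Rz']] := total_on_bigcup2 Ftot Uz Uz'.
    exact: Rf Rz Rz'.
  - move=> p p' z Uz Uz'.
    have [R [/FP[[_ _ Ri] _] Rz Rz']] := total_on_bigcup2 Ftot Uz Uz'.
    exact: Ri Rz Rz'.
move=> x y [z Uz] [t Ut].
have [R [FR Rz Rt]] := total_on_bigcup2 Ftot Uz Ut.
have [_ /(_ x y)[]] := FP _ FR; [by exists z|by exists t|].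
by move=> w Rw; exists w, R.
Qed.

Lemma square_injection_graph T (D : set T) (f : T * T -> T) :
  {in D `*` D &, injective f} -> {homo f : p / (D `*` D) p >-> D p} ->
  square_injection [set q | (D `*` D) q.1 /\ q.2 = f q.1].
Proof.
move=> finj fD; set R := [set q | _].
have domR : square_dom R = D.
  apply/seteqP; split=> [x [z [[]]]//|x Dx].
  by exists (f (x, x)); split.
rewrite /square_injection domR; split; last first.
  by move=> x y Dx Dy; exists (f (x, y)); split.
split=> /=.
- by move=> [p z] [/= Dp ->]; split=> //; exact: fD.
- by move=> p z z' [_ /= ->] [_ /= ->].
- move=> p p' z [/= Dp zp] [/= Dp' zp'].
  by apply: finj; rewrite ?in_setE// -zp -zp'.
Qed.

Section Extension.
Variables (T : Type) (D E : set T) (f : T * T -> T) (g : T -> T) (d0 d1 : T).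
Hypotheses (finj : {in D `*` D &, injective f})
  (fD : {homo f : p / (D `*` D) p >-> D p})
  (ginj : {in E &, injective g}) (gD : {homo g : x / E x >-> D x})
  (Dd0 : D d0) (Dd1 : D d1) (d01 : d0 <> d1).

(** Points of [D] are tagged with [d0], and the images under [g] of the other points with [d1]. This
    injects the union into the square of [D], which [f] sends back into [D]. *)
Lemma injects_setU : injects (D `|` E) D.
Proof.
pose c x := if x \in D then (x, d0) else (g x, d1).
have DE x : (D `|` E) x -> x \notin D -> E x.
  by move=> [Dx /negP[]|//]; rewrite in_setE.
have cD x : (D `|` E) x -> (D `*` D) (c x).
  move=> Ux; rewrite /c; case: ifPn => [/set_mem Dx|/DE -/(_ Ux) Ex] //.
  by split=> //; exact: gD.
exists (f \o c); split=> [x y /set_mem Ux /set_mem Uy|x /cD/fD//].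
move=> /finj; rewrite !in_setE => /(_ (cD _ Ux) (cD _ Uy)); rewrite /c.
case: ifPn => [_|/DE -/(_ Ux) Ex]; case: ifPn => [_|/DE -/(_ Uy) Ey] [] //.
- by move=> _ /esym/d01.
- by move/ginj; rewrite !in_setE; exact.
Qed.

Lemma injects_square_setU : injects ((D `|` E) `*` (D `|` E)) D.
Proof.
have [c [cinj cD]] := injects_setU.
exists (fun p => f (c p.1, c p.2)); split; last first.
  by move=> [x y] [/= Dx Dy]; apply: fD; split; exact: cD.
move=> [x y] [x' y'] /set_mem[/= Ux Uy] /set_mem[/= Ux' Uy'] /finj.
rewrite !in_setE => /(_ (conj (cD _ Ux) (cD _ Uy)) (conj (cD _ Ux') (cD _ Uy'))).
by move=> [/cinj + /cinj]; rewrite !in_setE => -> // ->.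
Qed.
End Extension.

(* Hessenberg's theorem: a maximal [D] with [D * D] injecting into [D] must be
   as large as [T], for otherwise [D] injects into its complement and
   [D] can be enlarged by a disjoint copy of itself. *)
Lemma injects_square T : infinite_set [set: T] ->
  exists f : T * T -> T, injective f.
Proof.
move=> /infiniteP/card_leTP[i iinj].
have [u uinj] : exists u : nat * nat -> nat, injective u.
  by apply/card_leTP; have := card_nat2; rewrite card_eq_le => /andP[].
have iT : inhabited T by exists; exact: (i 0%N).
(* [i'] inverts [i] on its range and takes the default value 0 elsewhere. *)
have /choice[i' iK] : forall x, exists n, forall m, x = i m -> n = m.
  move=> x; have [[m ->]|nx] := pselect (exists m, x = i m).
    by exists m => k /iinj.
  by exists 0%N => m xm; case: nx; exists m.
pose f0 p := i (u (i' p.1, i' p.2)).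
(* The seed is a square injection on the copy [range i] of the natural numbers. Starting from it
   guarantees that the maximal domain contains two distinct tags [d0] and [d1]. *)
have [R0 sqR0 [d0 [d1 [R0d0 R0d1 d01]]]] : exists2 R : set (T * T * T), square_injection R &
    exists x y, [/\ square_dom R x, square_dom R y & x <> y].
  exists [set q | (range i `*` range i) q.1 /\ q.2 = f0 q.1].
    apply: square_injection_graph => [[x y] [x' y']|p _]; last by exists (u (i' p.1, i' p.2)).
    move=> /set_mem[[n _ /= nx] [m _ /= my]] /set_mem[[n' _ /= nx'] [m' _ /= my']].
    move=> /iinj/uinj[]; rewrite -nx -nx' -my -my'.
    by do 4 rewrite (iK _ _ erefl); move=> -> ->.
  exists (i 0%N), (i 1%N); split; [| |by move/iinj].
  - by exists (f0 (i 0%N, i 0%N)); split=> //; split; exists 0%N.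
  - by exists (f0 (i 1%N, i 1%N)); split=> //; split; exists 1%N.
have [R [sqR subR Rmax]] : exists R, [/\ square_injection R, R0 `<=` R &
    forall R', square_injection R' -> R `<=` R' -> R' `<=` R].
  (* Taking unions with [R0] makes Zorn's lemma yield a maximal graph above [R0]. *)
  have [|A [PA Amax]] := @Zorn_bigcup _ (fun A => square_injection (A `|` R0)).
    (* The extra member [set0] makes the union equal to [R0] when the chain is empty. *)
    move=> F FP Ftot; pose F' := [set A `|` R0 | A in set0 |` F].
    have -> : \bigcup_(A in F) A `|` R0 = \bigcup_(A in F') A.
      apply/seteqP; split=> [q [[A FA Aq]|R0q]|q [_ [A FA <-]] [Aq|R0q]].
      - by exists (A `|` R0); [exists A => //; right|left].
      - by exists (set0 `|` R0); [exists set0 => //; left|right].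
      - by case: FA Aq => [-> []|FA Aq]; left; exists A.
      - by right.
    apply: square_injection_bigcup => [_ [A FA <-]|].
      by case: FA => [->|/FP //]; rewrite set0U.
    move=> _ _ [A FA <-] [B FB <-].
    have [] : A `<=` B \/ B `<=` A.
      by case: FA FB => [->|FA] [->|FB]; [left|left|right|exact: Ftot].
    - by left; exact: setSU.
    - by right; exact: setSU.
  exists (A `|` R0); split=> // R' sqR' AR'; apply: contrapT => nR'.
  apply: (Amax R'); last by rewrite (setUidl (subset_trans _ AR')) => // ? ?; right.
  split; first by move=> q Aq; apply: AR'; left.
  by move=> R'A; apply: nR' => q /R'A; left.
pose D := square_dom R.
have subD : square_dom R0 `<=` D by move=> x [z /subR]; exists z.
have [[RD Rf Ri] Rtot] := sqR.
have [|f [finj fD fR]] := partial_injection_fun iT sqR.1.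
  by move=> [x y] [/= Dx Dy]; exact: Rtot.
(* If the complement of [D] injects into [D], then so does all of [T], and [f] turns pairs of codes
   into elements of [D]. *)
have [jj|[g [ginj gD]]] := injects_total D (~` D) iT iT; last first.
  have [c [cinj cD]] := injects_setU finj fD ginj gD (subD _ R0d0) (subD _ R0d1) d01.
  exists (fun p => f (c p.1, c p.2)) => -[x y] [x' y'] /finj.
  rewrite setUv in cinj cD; rewrite !in_setE.
  move=> /(_ (conj (cD _ I) (cD _ I)) (conj (cD _ I) (cD _ I))).
  by move=> [/cinj + /cinj]; rewrite !in_setE => -> // ->.
have [j [jinj jD]] := jj; pose E := j @` D.
have /choice[g gK] : forall x, exists y, E x -> D y /\ j y = x.
  move=> x; have [[y Dy <-]|nEx] := pselect (E x); first by exists y.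
  by exists x => /nEx.
have gD : {homo g : x / E x >-> D x} by move=> x /gK[].
have ginj : {in E &, injective g}.
  by move=> x y /set_mem/gK[_ {2}<-] /set_mem/gK[_ {2}<-] ->.
have [h [hinj hD]] := injects_square_setU finj fD ginj gD (subD _ R0d0) (subD _ R0d1) d01.
(* Old pairs keep their values in [D]; new pairs are sent into [E], the copy of [D] in the
   complement, so the two kinds of values never collide. *)
pose U := D `|` E; pose f' p := if p \in D `*` D then f p else j (h p).
have f'inj : {in U `*` U &, injective f'}.
  move=> p q Up Uq; rewrite /f'.
  case: ifPn => [Dp|_]; case: ifPn => [Dq|_].
  - exact: finj.
  - move=> fj; have /jD[] : D (h q) by apply: hD; exact: set_mem.
    by rewrite -fj; apply: fD; exact: set_mem.
  - move=> fj; have /jD[] : D (h p) by apply: hD; exact: set_mem.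
    by rewrite fj; apply: fD; exact: set_mem.
  - move/jinj; rewrite !in_setE => jh; apply: hinj => //.
    by apply: jh; apply: hD; exact: set_mem.
have f'U : {homo f' : p / (U `*` U) p >-> U p}.
  move=> p Up; rewrite /f'; case: ifPn => [/set_mem Dp|_]; first by left; exact: fD.
  by right; exists (h p) => //; exact: hD.
have sqR' := square_injection_graph f'inj f'U.
have Dd0 := subD _ R0d0; have Ujd0 : U (j d0) by right; exists d0.
have RR' : R `<=` [set q | (U `*` U) q.1 /\ q.2 = f' q.1].
  move=> [p z] Rpz; have [/= Dp Dz] := RD _ Rpz.
  split=> /=; first by split; left; case: Dp.
  by rewrite /f' mem_set//; apply: Rf Rpz _; exact: fR.
(* Maximality would put [j d0] into [D], although [j] takes its values outside [D]. *)
have /RD[/= [/(jD _ Dd0)//]] : R ((j d0, j d0), f' (j d0, j d0)).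
by apply: (Rmax _ sqR' RR'); split; first by split.
Qed.

(** * Bases of elementary abelian 2-groups *)

(** Over the field with two elements a linear combination is the sum of a finite subset, given here
    by a duplicate-free list. *)
Definition lin_indep (A : zmodType) (I : set A) :=
  forall s : seq A, uniq s -> [set` s] `<=` I -> \sum_(x <- s) x = 0 ->
    s = [::].

Definition spanning (A : zmodType) (I : set A) :=
  forall a : A, exists s : seq A,
    [/\ uniq s, [set` s] `<=` I & \sum_(x <- s) x = a].

(** Reduction of a list modulo 2: elements of odd multiplicity are kept once, since equal terms
    cancel in pairs in [B]. It brings arbitrary lists within reach of [lin_indep]. *)
Lemma cancel_pairs (A : eqType) (s : seq A) :
  exists t, [/\ uniq t, forall x, (x \in t) = odd (count_mem x s)
    & forall (B : zmodType) (f : A -> B), elementary_abelian2_add B ->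
        \sum_(x <- t) f x = \sum_(x <- s) f x].
Proof.
elim: s => [|x s [t [ut ts tE]]]; first by exists [::].
have [xt|xt] := boolP (x \in t).
  exists (rem x t); split; first exact: rem_uniq.
    move=> y; rewrite mem_rem_uniq// inE ts /= oddD.
    by have [<-|] := eqVneq x y; rewrite /= ?eqxx -?ts ?xt// eq_sym => ->.
  move=> B f hB; rewrite big_cons -tE// (perm_big _ (perm_to_rem xt)) big_cons.
  by rewrite addrA hB add0r.
exists (x :: t); split=> /=; first by rewrite xt.
  move=> y; rewrite inE oddD eq_sym -ts.
  by have [<-|//] := eqVneq x y; rewrite (negPf xt).
by move=> B f hB; rewrite !big_cons tE.
Qed.

Section Basis.
Variable A : zmodType.
Hypothesis hA : elementary_abelian2_add A.

Lemma oppr_elementary (a : A) : - a = a.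
Proof. by apply/eqP; rewrite eq_sym -subr_eq0 opprK hA. Qed.

Lemma sum_cat_elementary (s t : seq A) :
  \sum_(x <- s) x = \sum_(x <- t) x -> \sum_(x <- s ++ t) x = 0.
Proof. by rewrite big_cat /= => ->; rewrite hA. Qed.

(** A maximal independent set [I] spans: for [a] outside [I], a relation in [I] enlarged by [a] must
    involve [a], and so expresses [a] by elements of [I]. *)
Lemma basis_exists : exists I : set A, lin_indep I /\ spanning I.
Proof.
have [|I [freeI Imax]] := @Zorn_bigcup _ (@lin_indep A).
  move=> F FP Ftot [//|x s]; move=> us sF s0.
  (* A finite list in the union of a chain lies in one member. The head [x] stays in the induction
     because the empty list would not provide any member. *)
  have [J [FJ sJ]] : exists J, F J /\ [set` x :: s] `<=` J.
    elim: s {us s0} sF => [|y s IHs] sF.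
      have [J FJ Jx] := sF x (mem_head _ _).
      by exists J; split=> // y; rewrite /= inE => /eqP ->.
    have [|J [FJ sJ]] := IHs.
      by move=> z; rewrite /= inE => zs; apply: sF; rewrite /= !inE; case/orP: zs => ->; rewrite ?orbT.
    have [K FK Ky] : (\bigcup_(X in F) X) y.
      by apply: sF; rewrite /= !inE eqxx orbT.
    have [JK|KJ] := Ftot _ _ FJ FK; [exists K|exists J]; split=> // z;
      rewrite /= !inE => /or3P[/eqP ->|/eqP ->|zs] //.
    - by apply: JK; apply: sJ; rewrite /= mem_head.
    - by apply: JK; apply: sJ; rewrite /= inE zs orbT.
    - by apply: sJ; rewrite /= mem_head.
    - exact: KJ.
    - by apply: sJ; rewrite /= inE zs orbT.
  exact: FP FJ _ us sJ s0.
exists I; split; first exact: freeI.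
move=> a; have [Ia|nIa] := pselect (I a).
  exists [:: a]; split=> //; last by rewrite big_seq1.
  by move=> x; rewrite /= inE => /eqP ->.
have : ~ lin_indep (a |` I).
  by apply: Imax; split; [exact: subsetUr|move=> /(_ a (or_introl erefl))].
move=> /existsNP[s /not_implyP[us /not_implyP[sI /not_implyP[s0 sN]]]].
have sIa x : x \in s -> x != a -> I x by move=> /sI[->|//]; rewrite eqxx.
have as_ : a \in s.
  apply: contrapT => /negP as_; apply: sN; apply: freeI => // x xs.
  by apply: sIa => //; apply: contraNneq as_ => <-.
exists (rem a s); split; first exact: rem_uniq.
  move=> x; rewrite /= mem_rem_uniq// inE => /andP[xa xs]; exact: sIa.
move: s0; rewrite (perm_big _ (perm_to_rem as_)) big_cons.
by move=> /= /eqP; rewrite addr_eq0 oppr_elementary => /eqP <-.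
Qed.

(** After cancellation of pairs, a vanishing sum over an independent set has no terms left. Hence
    the linear extension of a map on a basis is well defined. *)
Lemma sum_lin_indep (I : set A) (B : zmodType) (f : A -> B) (s : seq A) :
  elementary_abelian2_add B -> lin_indep I -> [set` s] `<=` I ->
  \sum_(x <- s) x = 0 -> \sum_(x <- s) f x = 0.
Proof.
move=> hB freeI sI s0; have [t [ut ts tE]] := cancel_pairs s.
rewrite -tE// (freeI t) ?big_nil ?(tE _ id)// => x /= xt.
by apply: sI; rewrite /= -has_pred1 has_count; apply: odd_gt0; rewrite -ts.
Qed.

(** Cancelling pairs in [s ++ t] leaves the symmetric difference, whose sum is zero and which is
    therefore empty. *)
Lemma lin_indep_sum_inj (I : set A) (s t : seq A) : lin_indep I ->
  uniq s -> uniq t -> [set` s] `<=` I -> [set` t] `<=` I ->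
  \sum_(x <- s) x = \sum_(x <- t) x -> s =i t.
Proof.
move=> freeI us ut sI tI st x; have [r [ur rst rE]] := cancel_pairs (s ++ t).
have r0 : r = [::].
  apply: freeI; rewrite ?(rE _ id)// ?sum_cat_elementary// => y /=.
  rewrite rst => /odd_gt0; rewrite -has_count has_pred1 mem_cat.
  by case/orP=> [/sI|/tI].
have := rst x; rewrite r0 count_cat !count_uniq_mem// oddD.
by case: (x \in s); case: (x \in t).
Qed.

(** Each element is the sum of exactly one subset of the basis, so subsets of ['I_n] enumerate the
    group. *)
Lemma card_finite_basis (I : set A) n : lin_indep I -> spanning I ->
  I #= `I_n -> [set: A] #= `I_(2 ^ n).
Proof.
move=> freeI spanI; rewrite card_eq_sym.
move=> /(card_eq_set_bij (inhabits 0))[b [bI binj bsurj]].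
pose s_ (X : {set 'I_n}) := [seq b (val i) | i <- enum X].
have us X : uniq (s_ X).
  rewrite map_inj_in_uniq ?enum_uniq// => i j _ _ /binj.
  by rewrite !in_setE /= => /(_ (ltn_ord i) (ltn_ord j))/val_inj.
have sI X : [set` s_ X] `<=` I.
  by move=> x /= /mapP[i _ ->]; apply: bI => /=.
pose F (X : {set 'I_n}) := \sum_(i in X) b (val i).
have Fs X : F X = \sum_(x <- s_ X) x by rewrite big_map big_enum.
have Fbij : bijective F.
  have Finj : injective F.
    move=> X Y; rewrite !Fs => XY; apply/setP => i.
    have /lin_indep_sum_inj/(_ _ _ _ _ XY) : lin_indep I by [].
    move=> /(_ (us _) (us _) (sI _) (sI _)) /(_ (b (val i))).
    have mem_s Z : (b (val i) \in s_ Z) = (i \in Z).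
      apply/mapP/idP => [[j + /binj]|iZ]; last by exists i; rewrite ?mem_enum.
      rewrite mem_enum !in_setE => jZ /(_ (ltn_ord i) (ltn_ord j))/val_inj.
      by move=> ->.
    by rewrite !mem_s.
  have Fsurj a : exists X, F X = a.
    have [s [su ssI <-]] := spanI a.
    have sb x : x \in s -> exists i : 'I_n, b (val i) = x.
      by move=> /ssI/bsurj[k /= kn kx]; exists (Ordinal kn).
    exists [set i : 'I_n | b (val i) \in s]%SET; rewrite Fs.
    apply: perm_big; apply: uniq_perm => // x; apply/mapP/idP => [[i]|xs].
      by rewrite mem_enum inE => + ->.
    by have [i ix] := sb _ xs; exists i; rewrite // mem_enum inE ix.
  have /choice[G GK] := Fsurj; exists G => // X; apply: Finj; exact: GK.
have -> : (2 ^ n)%N = #|{: {set 'I_n}}|.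
  rewrite -[in LHS](card_ord n) -cardsT -card_powerset; apply: eq_card => X.
  by rewrite !inE finset.subsetT.
apply: card_eq_trans (card_finType _).
by rewrite card_eq_sym; apply/card_eqTP; exists F.
Qed.

Lemma card_infinite_basis (I : set A) : spanning I -> infinite_set I ->
  [set: A] #= I.
Proof.
move=> spanI infI; apply: (card_eq_trans _ (card_setT I)).
have /injects_square[q qinj] : infinite_set [set: I].
  by rewrite (eq_finite_set (card_setT I)).
have [e einj] : exists e : nat -> I, injective e.
  by apply/card_leTP/infiniteP; rewrite (eq_finite_set (card_setT I)).
(* Lists over [I] are folded into [I] by the pairing [q]. The length is coded too, since the fold
   alone does not show where a list ends. *)
pose code (s : seq I) := q (e (size s), foldr (fun x y => q (x, y)) (e 0%N) s).
have codeinj : injective code.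
  move=> s t /qinj[/einj]; elim: s t => [|x s IHs] [|y t]//= [st] /qinj[-> fst].
  by rewrite (IHs t).
have /choice[s_ sP] : forall a, exists s : seq I, \sum_(x <- s) val x = a.
  move=> a; have [s [_ sI <-]] := spanI a.
  elim: s sI => [|x s IHs] sI; first by exists [::]; rewrite !big_nil.
  have [t tE] : exists t : seq I, \sum_(x <- t) val x = \sum_(x <- s) x.
    by apply: IHs => y ys; apply: sI; rewrite /= inE [y \in s]ys orbT.
  have Ix : I x by apply: sI; rewrite /= mem_head.
  by exists (SigSub (mem_set Ix) :: t); rewrite !big_cons tE.
rewrite card_eq_le; apply/andP; split; apply/card_leTP.
  exists (code \o s_) => a b /codeinj ab.
  by rewrite -(sP a) -(sP b) ab.
by exists val; exact: val_inj.
Qed.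

End Basis.

Lemma basis_bij_iso (A B : zmodType) (I : set A) (J : set B) :
  elementary_abelian2_add A -> elementary_abelian2_add B ->
  lin_indep I -> spanning I -> lin_indep J -> spanning J -> I #= J ->
  exists f : A -> B, bijective f /\ {morph f : x y / x + y}.
Proof.
move=> hA hB freeI spanI freeJ spanJ 
  /(card_eq_set_bij (inhabits 0))[f [fIJ finj fsurj]].
have /choice[s_ sP] := spanI.
pose F a := \sum_(x <- s_ a) f x.
(* [F] can be computed from any list with the given sum, not only from the chosen [s_ a]; additivity
   follows. *)
have FE (s : seq A) : [set` s] `<=` I -> F (\sum_(x <- s) x) = \sum_(x <- s) f x.
  move=> sI; set a := \sum_(x <- s) x; have [_ aI aE] := sP a.
  apply/eqP; rewrite -subr_eq0 oppr_elementary// /F -big_cat /=; apply/eqP.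
  apply: (sum_lin_indep hA f hB freeI); last by rewrite sum_cat_elementary.
  by move=> x; rewrite /= mem_cat => /orP[/aI|/sI].
have FD : {morph F : x y / x + y}.
  move=> a b; have [_ aI aE] := sP a; have [_ bI bE] := sP b.
  rewrite -{1}aE -{1}bE -big_cat FE ?big_cat//.
  by move=> x; rewrite /= mem_cat => /orP[/aI|/bI].
exists F; split=> //; have F0 a : F a = 0 -> a = 0.
  have [ua aI aE] := sP a => Fa0.
  have : map f (s_ a) = [::].
    apply: freeJ; last by rewrite big_map.
      rewrite map_inj_in_uniq// => x y xs ys; apply: finj; rewrite in_setE; exact: aI.
    by move=> y /mapP[x xs ->]; apply: fIJ; exact: aI.
  by move: aE; case: (s_ a) => // <-; rewrite big_nil.
have Finj : injective F.
  move=> a b Fab; apply/eqP; rewrite -subr_eq0 oppr_elementary//; apply/eqP/F0.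
  by rewrite FD Fab hB.
have Fsurj b : exists a, F a = b.
  have [t [_ tJ <-]] := spanJ b.
  have [s [sI <-]] : exists s, [set` s] `<=` I /\ map f s = t.
    elim: t tJ => [|y t IHt] tJ; first by exists [::].
    have [|s [sI <-]] := IHt; first by move=> z zt; apply: tJ; rewrite /= inE [z \in t]zt orbT.
    have [x Ix xy] : (f @` I) y by apply: fsurj; apply: tJ; rewrite /= mem_head.
    exists (x :: s); rewrite /= xy; split=> // z; rewrite /= inE.
    by case/orP => [/eqP ->//|/sI].
  by exists (\sum_(x <- s) x); rewrite FE// big_map.
have /choice[G GK] := Fsurj.
by exists G => // a; apply: Finj; rewrite GK.
Qed.

Lemma elementary_iso (A B : zmodType) :
  elementary_abelian2_add A -> elementary_abelian2_add B ->
  [set: A] #= [set: B] ->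
  exists f : A -> B, bijective f /\ {morph f : x y / x + y}.
Proof.
move=> hA hB AB; have [I [freeI spanI]] := basis_exists hA.
have [J [freeJ spanJ]] := basis_exists hB.
apply: (basis_bij_iso hA hB freeI spanI freeJ spanJ).
have [finI|infI] := pselect (finite_set I); last first.
  (* A finite [J] would make [B] finite, hence also [A] and its subset [I]. *)
  have infJ : infinite_set J.
    move=> /finite_setP[n /(card_finite_basis hB freeJ spanJ) Bn]; apply: infI.
    apply: sub_finite_set (@subsetT _ I) _; apply/finite_setP; exists (2 ^ n)%N.
    exact: card_eq_trans AB Bn.
  apply: card_eq_trans (card_eq_trans AB (card_infinite_basis spanJ infJ)).
  by rewrite card_eq_sym; exact: card_infinite_basis.
have /finite_setP[n In] := finI.
have An := card_finite_basis hA freeI spanI In.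
have /finite_setP[m Jm] : finite_set J.
  apply: sub_finite_set (@subsetT _ J) _; apply/finite_setP; exists (2 ^ n)%N.
  by apply: card_eq_trans An; rewrite card_eq_sym.
have Bm := card_finite_basis hB freeJ spanJ Jm.
have /card_eq_II/eqP : `I_(2 ^ n) #= `I_(2 ^ m).
  by apply: card_eq_trans (card_eq_trans AB Bm); rewrite card_eq_sym.
rewrite eqn_exp2l// => /eqP nm; apply: card_eq_trans In _.
by rewrite nm card_eq_sym.
Qed.

(** * Decomposition of an involutive solution *)

Lemma splitbijTK T U (e : {splitbij [set: T] >-> [set: U]}) :
  cancel e (e^-1)%FUN /\ cancel (e^-1)%FUN e.
Proof. by split=> x; [apply: funK|apply: invK]; rewrite in_setE. Qed.

Lemma sval_inj T (P : T -> Prop) : injective (@sval T P).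
Proof. by move=> [x Px] [y Py] /= xy; exact: eq_exist. Qed.

Lemma solution_ofE S (d : decomposition S) (sigma : dec_A d -> Sym (dec_X d)) p q :
  solution_of sigma (dec_bij d p, dec_bij d q) =
  cross (dec_bij d) (dec_bij d) (model_solution sigma (p, q)).
Proof.
by rewrite /solution_of /= !(splitbijTK (dec_bij d)).1.
Qed.

(** * Additive and multiplicative groups built from a bare operation *)

Section ElementaryStructures.
Variables (T : Type) (e : T) (op : T -> T -> T).
Hypotheses (opA : associative op) (opC : commutative op)
  (op1 : left_id e op) (opxx : forall x, op x x = e).

Let C : choiceType := HB.pack T (gen_eqMixin T) (gen_choiceMixin T).

Definition elementary_zmod : zmodType :=
  HB.pack T C (@GRing.isZmodule.Build C e id op opA opC op1 opxx).

Lemma elementary_zmodP : elementary_abelian2_add elementary_zmod.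
Proof. exact: opxx. Qed.

Let opr1 : right_id e op.
Proof. by move=> x; rewrite opC op1. Qed.

Definition elementary_group : groupType :=
  HB.pack T C (@isGroup.Build C e id op opA op1 opr1 opxx opxx).

Lemma elementary_groupP : elementary_abelian2_mul elementary_group.
Proof. by split; [exact: opC|exact: opxx]. Qed.
End ElementaryStructures.

(** * Identities in an involutive solution *)

Section InvolutiveSolution.
Variables (S : Type) (s : S * S -> S * S).
Hypotheses (s_pentagon : pentagon_equation s) (sK : involutive s).

Let mul x y := (s (x, y)).1.
Let theta x y := (s (x, y)).2.
Local Notation "x ∙ y" := (mul x y) (at level 40, left associativity).

Let sE x y : s (x, y) = (x ∙ y, theta x y).
Proof. exact: surjective_pairing. Qed.

Let s12E x y z : s12 s (x, y, z) = (x ∙ y, theta x y, z).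
Proof. by rewrite /s12 /cross /= sE. Qed.

Let s23E x y z : s23 s (x, y, z) = (x, y ∙ z, theta y z).
Proof. by rewrite /s23 sE. Qed.

Let s13E x y z : s13 s (x, y, z) = (x ∙ z, y, theta x z).
Proof. by rewrite /s13 /s23 /cross /swap_pair /= sE. Qed.

Let s12K : involutive (s12 s).
Proof. by move=> [[x y] z]; rewrite /s12 /cross /= sK. Qed.

Let s23K : involutive (s23 s).
Proof. by move=> [[x y] z]; have := sK (y, z); rewrite !s23E !sE => -[-> ->]. Qed.

Let s13K : involutive (s13 s).
Proof. by move=> [[x y] z]; have := sK (x, z); rewrite !s13E !sE => -[-> ->]. Qed.

Let pentagonE t : s23 s (s13 s (s12 s t)) = s12 s (s23 s t).
Proof. exact: s_pentagon. Qed.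

(** Invert both sides of the pentagon equation: all three factors are involutions. *)
Let reversed_pentagon t : s12 s (s13 s (s23 s t)) = s23 s (s12 s t).
Proof.
apply: (inv_inj s23K); apply: (inv_inj s12K).
by rewrite s23K s12K -pentagonE s12K s13K s23K.
Qed.

(** The three components of the pentagon equation come first, then those of the reversed one, then
    the two of [sK]. *)
Let mulA x y z : x ∙ (y ∙ z) = x ∙ y ∙ z.
Proof. by have := pentagonE (x, y, z); rewrite !(s12E, s13E, s23E) => -[]. Qed.

Let thetaM x y z : theta x y ∙ theta (x ∙ y) z = theta x (y ∙ z).
Proof. by have := pentagonE (x, y, z); rewrite !(s12E, s13E, s23E) => -[]. Qed.

Let theta_theta x y z : theta (theta x y) (theta (x ∙ y) z) = theta y z.
Proof. by have := pentagonE (x, y, z); rewrite !(s12E, s13E, s23E) => -[]. Qed.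

Let mul_rev x y z : x ∙ theta y z ∙ (y ∙ z) = x ∙ y.
Proof. by have := reversed_pentagon (x, y, z); rewrite !(s12E, s13E, s23E) => -[]. Qed.

Let thetaM_rev x y z : theta (x ∙ theta y z) (y ∙ z) = theta x y ∙ z.
Proof. by have := reversed_pentagon (x, y, z); rewrite !(s12E, s13E, s23E) => -[]. Qed.

Let theta_theta_rev x y z : theta x (theta y z) = theta (theta x y) z.
Proof. by have := reversed_pentagon (x, y, z); rewrite !(s12E, s13E, s23E) => -[]. Qed.

Let mulK x y : x ∙ y ∙ theta x y = x.
Proof. by have := sK (x, y); rewrite !sE => -[]. Qed.

Let thetaK x y : theta (x ∙ y) (theta x y) = y.
Proof. by have := sK (x, y); rewrite !sE => -[]. Qed.

(** Replace [(x, y)] by [s (x, y)] in [theta_theta]; as [s] is involutive, this exchanges the roles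
    of the two pairs. *)
Let thetaC x y z : theta x (theta y z) = theta y (theta x z).
Proof.
have := theta_theta (x ∙ y) (theta x y) z; rewrite thetaK mulK.
by rewrite -theta_theta_rev => ->.
Qed.

Let theta_surj y z : exists w, theta y w = z.
Proof. by exists (theta (y ∙ z) z); rewrite thetaC thetaK. Qed.

Let theta_mulK x y z : theta x (theta (x ∙ y) z) = z.
Proof.
have [w <-] := theta_surj y z.
by rewrite [theta (x ∙ y) _]thetaC theta_theta_rev theta_theta.
Qed.

(** By [theta_mulK], appending two factors to [x] does not change its map. Since [x] equals
    [x ∙ x ∙ theta x x], the product [x ∙ y] is [x] followed by the two factors [x] and
    [theta x x ∙ y]. *)
Let theta_mul x y z : theta (x ∙ y) z = theta x z.
Proof.
have theta_mul2 a b c t : theta (a ∙ b ∙ c) t = theta a t.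
  by rewrite -[LHS](theta_mulK a b) [theta (a ∙ b) _]theta_mulK.
by rewrite -[in LHS](mulK x x) -mulA theta_mul2.
Qed.

Let theta2 x : involutive (theta x).
Proof. by move=> z; rewrite -{2}(theta_mulK x x z) theta_mul. Qed.

(** With [w] written as [theta x (theta x w)], both sides equal [theta x (theta x w ∙ z)], by
    [thetaM] and by [thetaM_rev]. *)
Let mul_theta w x z : w ∙ theta x z = w ∙ z.
Proof.
by rewrite -(theta2 x w) -[in RHS]thetaM_rev theta_mul -thetaM theta_mul.
Qed.

Let theta_mulr x y z : theta x (y ∙ z) = theta x y ∙ z.
Proof. by rewrite -thetaM_rev theta_mul. Qed.

Let mul2 x y : x ∙ y ∙ y = x.
Proof. by rewrite -[RHS](mulK x y) mul_theta. Qed.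

Let mulAC x y z : x ∙ y ∙ z = x ∙ z ∙ y.
Proof.
have := mul_rev x y z; rewrite mul_theta mulA => <-.
by rewrite mul2.
Qed.

(** * Coordinates relative to a base point *)

Section BasePoint.
Variable u0 : S.

(** A point inducing the identity in both ways: [theta u0] cancels the map of [u0 ∙ u0], and right
    multiplication by [u0 ∙ u0] is trivial. *)
Let o := theta u0 (u0 ∙ u0).

Let theta_o z : theta o z = z.
Proof. by rewrite /o -theta_theta_rev theta_mul theta2. Qed.

Let mul_o w : w ∙ o = w.
Proof. by rewrite /o mul_theta mulA mul2. Qed.

(** Each map [theta u] is represented by its value at [o], and each right multiplication by [o ∙ u].
    So [A] and [G] are the orbits of [o] under the two actions, while points of [X] act trivially in
    both ways. *)
Let A := {a | theta a o = a}.
Let G := {g | o ∙ g = g}.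
Let X := {x | theta x o = o /\ o ∙ x = o}.

Let theta_X (x : X) z : theta (sval x) z = z.
Proof.
case: x => x /= [xo _].
by rewrite -[z in LHS]theta_o theta_theta_rev xo theta_o.
Qed.

Let mul_X (x : X) w : w ∙ sval x = w.
Proof. by case: x => x /= [_ ox]; rewrite -[w in LHS]mul_o -mulA ox mul_o. Qed.

Let addA_subproof (a b : A) : theta (theta (sval a) (sval b)) o = theta (sval a) (sval b).
Proof. by rewrite -theta_theta_rev (svalP b). Qed.

Let mulG_subproof (g h : G) : o ∙ (sval g ∙ sval h) = sval g ∙ sval h.
Proof. by rewrite mulA (svalP g). Qed.

Let addA_ (a b : A) : A := exist _ _ (addA_subproof a b).
Let mulG_ (g h : G) : G := exist _ _ (mulG_subproof g h).
Let zeroA : A := exist _ o (theta_o o).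
Let oneG : G := exist _ o (mul_o o).

Let addA_A : associative addA_.
Proof. by move=> a b c; apply: eq_exist; rewrite /= theta_theta_rev. Qed.

Let addA_C : commutative addA_.
Proof.
move=> a b; apply: eq_exist => /=.
by rewrite -[in LHS](svalP b) thetaC (svalP a).
Qed.

Let add0A : left_id zeroA addA_.
Proof. by move=> [a ao]; apply: eq_exist; rewrite /= theta_o. Qed.

Let addAA a : addA_ a a = zeroA.
Proof.
apply: eq_exist; rewrite /= -[in X in theta _ X](svalP a).
exact: theta2.
Qed.

Let mulG_A : associative mulG_.
Proof. by move=> a b c; apply: eq_exist; rewrite /= mulA. Qed.

Let mulG_C : commutative mulG_.
Proof.
move=> g h; apply: eq_exist => /=.
by rewrite -[in LHS](svalP g) mulAC (svalP h).
Qed.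

Let mul1G : left_id oneG mulG_.
Proof. by move=> [g go]; apply: eq_exist. Qed.

Let mulGG g : mulG_ g g = oneG.
Proof. by apply: eq_exist; rewrite /= -[in X in X ∙ _](svalP g) mul2. Qed.

Let zA := elementary_zmod addA_A addA_C add0A addAA.
Let gG := elementary_group mulG_A mulG_C mul1G mulGG.

Let glue (p : X * zA * gG) : S := theta (sval p.1.2) (sval p.1.1) ∙ sval p.2.

Let xpart_subproof u :
  theta (theta u (u ∙ u)) o = o /\ o ∙ theta u (u ∙ u) = o.
Proof.
split; first by rewrite -theta_theta_rev theta_mul theta2.
by rewrite mul_theta mulA mul2.
Qed.

Let apart_subproof u : theta (theta u o) o = theta u o.
Proof. by rewrite -theta_theta_rev theta_o. Qed.

Let gpart_subproof u : o ∙ (o ∙ u) = o ∙ u.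
Proof. by rewrite mulA mul_o. Qed.

(** In the first coordinate, right multiplication by [u] removes the [G]-part of [u] and [theta u]
    its [A]-part, both being involutions. *)
Let split_ u : X * zA * gG :=
  (exist _ _ (xpart_subproof u), exist _ _ (apart_subproof u),
   exist _ _ (gpart_subproof u)).

Let split_K : cancel split_ glue.
Proof.
move=> u; rewrite /glue /= -theta_theta_rev theta_o theta2.
by rewrite mulA mul_o !mul2.
Qed.

Let glueK : cancel glue split_.
Proof.
move=> [[x a] g]; rewrite /glue /=.
have xag : theta (sval a) (sval x) ∙ sval g ∙ (theta (sval a) (sval x) ∙ sval g) =
    theta (sval a) (sval x).
  by rewrite mulA mulAC mul2 mul_theta mul_X.
congr (_, _, _); apply: sval_inj => /=.
- by rewrite xag theta_mul -theta_theta_rev theta_X theta2.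
- by rewrite theta_mul -theta_theta_rev theta_X (svalP a).
- by rewrite mulA mul_theta mul_X (svalP g).
Qed.

Lemma involutive_solution_decomposition_at : exists d : decomposition S,
  s =1 solution_of (fun _ : dec_A d => [splitbij of @idfun (dec_X d)]).
Proof.
have glue_bij : bijective glue by exists split_.
pose e := bijection_of_bijective glue_bij.
have oX : inhabited X by exists; exists o; split; [exact: theta_o|exact: mul_o].
pose d := Decomposition oX (@elementary_zmodP _ _ _ addA_A addA_C add0A addAA)
  (@elementary_groupP _ _ _ mulG_A mulG_C mul1G mulGG) e.
exists d => -[u v]; have [_ Ke] := splitbijTK e.
rewrite -(Ke u) -(Ke v) -[e]/(dec_bij d) solution_ofE.
case: (_ u) => -[x a] g; case: (_ v) => -[y b] h.
rewrite /cross /= /glue /=.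
rewrite sE; congr (_, _).
  by rewrite !mulA mul_theta mul_X.
rewrite theta_mul theta_mulr -!theta_theta_rev theta_X.
by congr (theta _ (theta _ _) ∙ _).
Qed.
End BasePoint.

Lemma involutive_solution_decomposition : inhabited S ->
  exists d : decomposition S,
    s =1 solution_of (fun _ : dec_A d => [splitbij of @idfun (dec_X d)]).
Proof. by move=> [u]; exact: involutive_solution_decomposition_at u. Qed.

End InvolutiveSolution.

(** * Isomorphisms between solutions *)

Lemma isomorphic_refl S (s : S * S -> S * S) : isomorphic s s.
Proof.
exists id; split; first by exists id.
by move=> p /=; rewrite /cross /= -surjective_pairing; case: p.
Qed.

Lemma isomorphic_sym S S' (s : S * S -> S * S) (s' : S' * S' -> S' * S') :
  isomorphic s s' -> isomorphic s' s.
Proof.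
move=> [f [[g fK gK] fs]]; exists g; split; first by exists f.
move=> [x y]; have /= := fs (g x, g y); rewrite /cross /= !gK => <- /=.
by rewrite !fK -surjective_pairing.
Qed.

Lemma isomorphic_trans S1 S2 S3 (s1 : S1 * S1 -> S1 * S1)
    (s2 : S2 * S2 -> S2 * S2) (s3 : S3 * S3 -> S3 * S3) :
  isomorphic s1 s2 -> isomorphic s2 s3 -> isomorphic s1 s3.
Proof.
move=> [f [fbij fs]] [g [gbij gs]]; exists (g \o f); split; first exact: bij_comp.
move=> p; have := gs (cross f f p); rewrite /=.
by have /= := fs p => <-.
Qed.

(** The threefold product [F] of [f] intertwines each of [s12], [s13], [s23] with its counterpart
    for [s']. *)
Lemma isomorphic_involutive S S' (s : S * S -> S * S) (s' : S' * S' -> S' * S') :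
  isomorphic s s' -> involutive_solution s -> involutive_solution s'.
Proof.
move=> [f [[g fK gK] fs]] [sPE sK].
pose F (t : S * S * S) := (f t.1.1, f t.1.2, f t.2).
have s'E x y : s' (f x, f y) = cross f f (s (x, y)) by have /= := fs (x, y) => <-.
have F12 t : s12 s' (F t) = F (s12 s t).
  by case: t => -[x y] z; rewrite /s12 /cross /= s'E.
have F23 t : s23 s' (F t) = F (s23 s t).
  by case: t => -[x y] z; rewrite /s23 /= s'E; case: (s _).
have F13 t : s13 s' (F t) = F (s13 s t).
  case: t => -[x y] z; rewrite /s13 /= /cross /= /s23 /= /cross /swap_pair /= s'E.
  by case: (s _).
split=> [[[x y] z]|[x y]].
  rewrite -(gK x) -(gK y) -(gK z) -[(_, _, _)]/(F (g x, g y, g z)).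
  have -> t : (s23 s' \o s13 s' \o s12 s') (F t) = F ((s23 s \o s13 s \o s12 s) t).
    by rewrite -[LHS]/(s23 s' (s13 s' (s12 s' (F t)))) F12 F13 F23.
  by rewrite sPE -[RHS]/(s12 s' (s23 s' (F _))) F23 F12.
rewrite -(gK x) -(gK y) s'E; case E : (s (g x, g y)) => [u v].
by rewrite /cross /= s'E -E sK /cross.
Qed.

Lemma solution_of_isomorphic S (d : decomposition S)
    (sigma : dec_A d -> Sym (dec_X d)) :
  isomorphic (@model_solution _ _ (dec_G d) sigma) (solution_of sigma).
Proof.
have [eK Ke] := splitbijTK (dec_bij d).
exists (dec_bij d); split; first by exists (dec_bij d)^-1%FUN.
by move=> [p q]; rewrite /= -solution_ofE.
Qed.

(** Consecutive factors of [sigma] telescope, and the indices agree because [a + b + (a + c)] is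
    [b + c]. *)
Lemma model_involutive_solution (X : Type) (A : zmodType) (G : groupType)
    (sigma : A -> Sym X) :
  elementary_abelian2_add A -> elementary_abelian2_mul G ->
  involutive_solution (@model_solution X A G sigma).
Proof.
move=> hA [_ hG]; have sK a : cancel (sigma a) (sigma a)^-1%FUN := (splitbijTK _).1.
have Ks a : cancel (sigma a)^-1%FUN (sigma a) := (splitbijTK _).2.
have ab (a b : A) : a + (a + b) = b by rewrite addrA hA add0r.
have abac (a b c : A) : a + b + (a + c) = b + c.
  by rewrite addrACA hA add0r.
split=> [[[[[x a] g] [[y b] h]] [[z c] k]]|[[[x a] g] [[y b] h]]].
  rewrite /= /s12 /s23 /s13 /cross /= /s23 /swap_pair /=.
  by rewrite sK abac monoid.mulgA.
by rewrite /= sK ab Ks -monoid.mulgA hG monoid.mulg1.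
Qed.

Lemma elementary_group_iso (G H : groupType) :
  elementary_abelian2_mul G -> elementary_abelian2_mul H ->
  [set: G] #= [set: H] ->
  exists f : G -> H, bijective f /\ {morph f : x y / (x * y)%g}.
Proof.
move=> [GC G2] [HC H2] GH.
have [f [fbij fD]] := @elementary_iso
  (elementary_zmod (@monoid.mulgA G) GC (@monoid.mul1g G) G2)
  (elementary_zmod (@monoid.mulgA H) HC (@monoid.mul1g H) H2) G2 H2 GH.
by exists f.
Qed.

Section ModelIsomorphisms.
Variables (X1 X2 : Type) (A1 A2 : zmodType) (G1 G2 : groupType).
Variables (sigma1 : A1 -> Sym X1) (sigma2 : A2 -> Sym X2).
Let m1 := @model_solution X1 A1 G1 sigma1.
Let m2 := @model_solution X2 A2 G2 sigma2.

Lemma model_isomorphic : 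
  elementary_abelian2_add A1 -> elementary_abelian2_add A2 ->
  elementary_abelian2_mul G1 -> elementary_abelian2_mul G2 ->
  [set: X1] #= [set: X2] -> [set: A1] #= [set: A2] -> [set: G1] #= [set: G2] ->
  isomorphic m1 m2.
Proof.
move=> hA1 hA2 hG1 hG2 /card_eqTP[k [k' kK Kk]] /(elementary_iso hA1 hA2).
move=> [phi [[phi' phiK Kphi] phiD]] /(elementary_group_iso hG1 hG2).
move=> [psi [[psi' psiK Kpsi] psiM]].
have sK1 a : cancel (sigma1 a) (sigma1 a)^-1%FUN := (splitbijTK _).1.
have Ks1 a : cancel (sigma1 a)^-1%FUN (sigma1 a) := (splitbijTK _).2.
have sK2 a : cancel (sigma2 a) (sigma2 a)^-1%FUN := (splitbijTK _).1.
have Ks2 a : cancel (sigma2 a)^-1%FUN (sigma2 a) := (splitbijTK _).2.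
(* Undoing [sigma1 a] reduces the first model to a trivial [sigma]; [k] changes the set, and
   [sigma2 (phi a)] twists the result into the second model. *)
pose f (u : X1 * A1 * G1) : X2 * A2 * G2 := let: (x, a, g) := u in
  (sigma2 (phi a) (k ((sigma1 a)^-1%FUN x)), phi a, psi g).
pose f' (u : X2 * A2 * G2) : X1 * A1 * G1 := let: (x, a, g) := u in
  (sigma1 (phi' a) (k' ((sigma2 a)^-1%FUN x)), phi' a, psi' g).
exists f; split.
  exists f' => -[[x a] g]; rewrite /f /f'.
    by rewrite phiK psiK sK2 kK Ks1.
  by rewrite Kphi Kpsi sK1 Kk Ks2.
by move=> [[[x a] g] [[y b] h]]; rewrite /cross /= !sK1 sK2 phiD psiM.
Qed.

(** The factors are read off from the solution: [X] from points [u] fixed by the diagonal action,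
    [A] from the dependence of the second output on the first input, [G] from that of the first
    output on the second input. *)
Lemma isomorphic_model_injections : inhabited X1 ->
  isomorphic m1 m2 ->
  [/\ [set: X1] #<= [set: X2], [set: A1] #<= [set: A2]
    & [set: G1] #<= [set: G2]].
Proof.
move=> [x0] [f [[f' fK _] fm]]; have finj := can_inj fK.
have fm1 u v : f (m1 (u, v)).1 = (m2 (f u, f v)).1
  by rewrite -[RHS](congr1 fst (fm (u, v))).
have fm2 u v : f (m1 (u, v)).2 = (m2 (f u, f v)).2
  by rewrite -[RHS](congr1 snd (fm (u, v))).
(* The pair [(u, u)] is fixed by [m1], so its image is fixed by [m2], which makes the [A]- and
   [G]-parts of [f u] idempotent, hence neutral. *)
have fx x : exists y, f (x, 0, 1%g) = (y, 0, 1%g).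
  pose u : X1 * A1 * G1 := (x, 0, 1%g).
  have := fm1 u u; have := fm2 u u.
  rewrite /m1 /m2 /= addr0 monoid.mulg1 (splitbijTK (sigma1 0)).2 -/u.
  case: (f u) => -[y a] g /= [_ a0] [g1]; exists y; congr (_, _, _).
    by apply: (addIr a); rewrite add0r.
  by apply: (monoid.mulIg g); rewrite monoid.mul1g.
split; apply/card_leTP.
- have /choice[h hP] := fx; exists h => x y hxy.
  by have := hP x; rewrite hxy -hP => /finj[].
- exists (fun a => (f (x0, a, 1%g)).1.2) => a b ab.
  have : (m2 (f (x0, a, 1%g), f (x0, a, 1%g))).2 = (m2 (f (x0, b, 1%g), f (x0, a, 1%g))).2.
    move: ab; case: (f (x0, a, 1%g)) => -[y c] g; case: (f (x0, b, 1%g)) => -[z e] h /=.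
    by move=> ->.
  by rewrite -!fm2 => /finj[_ /addIr].
- exists (fun g => (f (x0, 0, g)).2) => g h gh.
  have : (m2 (f (x0, 0, g), f (x0, 0, g))).1 = (m2 (f (x0, 0, g), f (x0, 0, h))).1.
    move: gh; case: (f (x0, 0, g)) => -[y c] g'; case: (f (x0, 0, h)) => -[z e] h' /=.
    by move=> ->.
  by rewrite -!fm1 => /finj[/monoid.mulgI].
Qed.
End ModelIsomorphisms.

(** * Classification up to isomorphism *)

Lemma solution_of_isomorphicP S (d1 d2 : decomposition S)
    (sigma1 : dec_A d1 -> Sym (dec_X d1)) (sigma2 : dec_A d2 -> Sym (dec_X d2)) :
  isomorphic (solution_of sigma1) (solution_of sigma2) <-> same_cardinalities d1 d2.
Proof.
have i1 := solution_of_isomorphic sigma1; have i2 := solution_of_isomorphic sigma2.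
split=> [i12|[eX eA eG]].
  have j12 := isomorphic_trans i1 (isomorphic_trans i12 (isomorphic_sym i2)).
  have [X12 A12 G12] := isomorphic_model_injections (dec_X_nonempty d1) j12.
  have [X21 A21 G21] :=
    isomorphic_model_injections (dec_X_nonempty d2) (isomorphic_sym j12).
  (* Injections in both directions give equal cardinalities, by the Cantor-Bernstein theorem. *)
  by split; rewrite card_eq_le ?X12 ?A12 ?G12.
apply: isomorphic_trans (isomorphic_sym i1) (isomorphic_trans _ i2).
by apply: model_isomorphic => //; [exact: dec_A_elementary..|exact: dec_G_elementary|exact: dec_G_elementary].
Qed.

Lemma iso_class_eq S (s t : S * S -> S * S) :
  isomorphic s t -> iso_class s = iso_class t.
Proof.
move=> st; apply/seteqP; split=> u [uP su]; split=> //.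
  exact: isomorphic_trans (isomorphic_sym st) su.
exact: isomorphic_trans st su.
Qed.

Lemma iso_class_mem S (s : S * S -> S * S) : involutive_solution s -> iso_class s s.
Proof. by split=> //; exact: isomorphic_refl. Qed.

Lemma solution_of_involutive S (d : decomposition S)
    (sigma : dec_A d -> Sym (dec_X d)) : involutive_solution (solution_of sigma).
Proof.
apply: isomorphic_involutive (solution_of_isomorphic sigma) _.
by apply: model_involutive_solution; [exact: dec_A_elementary|exact: dec_G_elementary].
Qed.

Definition trivial_solution S (d : decomposition S) : S * S -> S * S :=
  solution_of (fun _ : dec_A d => [splitbij of @idfun (dec_X d)]).

Lemma involutive_solutionE S (s : S * S -> S * S) : inhabited S ->
  involutive_solution s -> exists d : decomposition S, s = trivial_solution d.
Proof.
move=> iS [sPE sK]; have [d sd] := involutive_solution_decomposition sPE sK iS.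
by exists d; exact/funext.
Qed.

Lemma classes_biject_with_decompositionsP S : inhabited S -> classes_biject_with_decompositions S.
Proof.
move=> iS; split=> [_ [s sP <-]|d].
  have [d sd] := involutive_solutionE iS sP; exists d => d'.
  split=> [[sigma' [_]]|dd']; first by rewrite sd => /solution_of_isomorphicP.
  exists (fun=> [splitbij of idfun]); split; first exact: solution_of_involutive.
  by rewrite sd; apply/solution_of_isomorphicP.
have dP : involutive_solution (trivial_solution d) := solution_of_involutive _.
exists (iso_class (trivial_solution d)); split.
  split; first by exists (trivial_solution d).
  by exists (fun=> [splitbij of idfun]); exact: iso_class_mem.
move=> _ [[s sP <-] [sigma [_ s_sigma]]]; apply: iso_class_eq.
apply: isomorphic_trans (isomorphic_sym s_sigma).
by apply/solution_of_isomorphicP; split; exact: card_eqxx.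
Qed.

(** * Counting the classes on a finite set *)

Lemma card_setXT T U a b : [set: T] #= `I_a -> [set: U] #= `I_b ->
  [set: T * U] #= `I_(a * b).
Proof.
rewrite !(card_eqr card_II) => /card_eqTP[f [f' fK Kf]] /card_eqTP[g [g' gK Kg]].
rewrite -(card_eqr card_II).
have <- : #|{: 'I_a * 'I_b}| = (a * b)%N by rewrite card_prod !card_ord.
apply: card_eq_trans (card_finType _); apply/card_eqTP.
exists (fun p => (f p.1, g p.2)), (fun p => (f' p.1, g' p.2)) => -[x y] /=.
  by rewrite fK gK.
by rewrite Kf Kg.
Qed.

Lemma card_elementary_zmod (A : zmodType) : elementary_abelian2_add A ->
  finite_set [set: A] -> exists i, [set: A] #= `I_(2 ^ i).
Proof.
move=> hA finA; have [I [freeI spanI]] := basis_exists hA.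
have /finite_setP[i In] := sub_finite_set (@subsetT _ I) finA.
by exists i; exact: card_finite_basis In.
Qed.

Lemma card_elementary_group (G : groupType) : elementary_abelian2_mul G ->
  finite_set [set: G] -> exists i, [set: G] #= `I_(2 ^ i).
Proof.
move=> [GC G2]; exact: (@card_elementary_zmod
  (elementary_zmod (@monoid.mulgA G) GC (@monoid.mul1g G) G2) G2).
Qed.

Section BoolPower.
Variable n : nat.
Let T := {ffun 'I_n -> bool}.
Let xor (f g : T) : T := [ffun i => f i (+) g i].
Let zero : T := [ffun=> false].

Let xorA : associative xor.
Proof. by move=> f g h; apply/ffunP => i; rewrite !ffunE addbA. Qed.
Let xorC : commutative xor.
Proof. by move=> f g; apply/ffunP => i; rewrite !ffunE addbC. Qed.
Let xor0 : left_id zero xor.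
Proof. by move=> f; apply/ffunP => i; rewrite !ffunE. Qed.
Let xorxx f : xor f f = zero.
Proof. by apply/ffunP => i; rewrite !ffunE addbb. Qed.

Let cardT : [set: T] #= `I_(2 ^ n).
Proof.
have <- : #|{: T}| = (2 ^ n)%N by rewrite card_ffun card_bool card_ord.
exact: card_finType.
Qed.

(** Bit vectors of length [n] under exclusive or. *)
Lemma elementary_zmod_exists : exists A : zmodType,
  elementary_abelian2_add A /\ [set: A] #= `I_(2 ^ n).
Proof. by exists (elementary_zmod xorA xorC xor0 xorxx). Qed.

Lemma elementary_group_exists : exists G : groupType,
  elementary_abelian2_mul G /\ [set: G] #= `I_(2 ^ n).
Proof.
by exists (elementary_group xorA xorC xor0 xorxx); split=> //; exact: elementary_groupP.
Qed.
End BoolPower.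

Section Count.
Variables (S : Type) (n m : nat).
Hypotheses (S_nonempty : inhabited S) (cardS : [set: S] #= `I_(2 ^ n * (2 * m + 1))).

(** The exponents of [A] and [G] determine the size of [X], which always absorbs the odd factor of
    [|S|]. The subtraction is truncated, so the formula is meant for [i + j <= n]. *)
Definition has_type (s : S * S -> S * S) i j := exists d : decomposition S,
  [/\ s = trivial_solution d, [set: dec_X d] #= `I_(2 ^ (n - (i + j)) * (2 * m + 1)),
      [set: dec_A d] #= `I_(2 ^ i) & [set: dec_G d] #= `I_(2 ^ j)].

Lemma has_type_exists i j : (i + j <= n)%N -> exists s, has_type s i j.
Proof.
move=> ijn; have [A [hA cA]] := elementary_zmod_exists i.
have [G [hG cG]] := elementary_group_exists j.
pose k := (2 ^ (n - (i + j)) * (2 * m + 1))%N.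
have cX : [set: 'I_k] #= `I_k by rewrite (card_eqr card_II) card_eqxx.
have k0 : (0 < k)%N by rewrite muln_gt0 expn_gt0 addn1.
have iX : inhabited 'I_k by exists; exact: Ordinal k0.
have /card_eqTP[e ebij] : [set: 'I_k * A * G] #= [set: S].
  rewrite card_eq_sym; apply: card_eq_trans cardS _; rewrite card_eq_sym.
  have -> : (2 ^ n * (2 * m + 1) = k * 2 ^ i * 2 ^ j)%N.
    by rewrite -{1}(subnK ijn) !expnD mulnAC mulnA.
  exact: card_setXT (card_setXT cX cA) cG.
pose d := Decomposition iX hA hG (bijection_of_bijective ebij).
by exists (trivial_solution d), d.
Qed.

Lemma has_type_isomorphic s t i j : has_type s i j -> has_type t i j -> isomorphic s t.
Proof.
move=> [d [-> X A G]] [d' [-> X' A' G']]; apply/solution_of_isomorphicP.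
by split; [apply: card_eq_trans X _|apply: card_eq_trans A _|apply: card_eq_trans G _];
  rewrite card_eq_sym.
Qed.

Lemma has_type_inj s t i j i' j' : has_type s i j -> has_type t i' j' ->
  isomorphic s t -> i = i' /\ j = j'.
Proof.
move=> [d [-> _ A G]] [d' [-> _ A' G']] /solution_of_isomorphicP[_ AA GG].
have exp2_inj a b (T U : Type) : [set: T] #= `I_(2 ^ a) -> [set: U] #= `I_(2 ^ b) ->
    [set: T] #= [set: U] -> a = b.
  move=> Ta Ub TU; apply/eqP; rewrite -(@eqn_exp2l 2)//; apply/eqP/card_eq_II.
  by apply: card_eq_trans (card_eq_trans TU Ub); rewrite card_eq_sym.
by split; [exact: exp2_inj A A' AA|exact: exp2_inj G G' GG].
Qed.

Lemma involutive_solution_has_type s : involutive_solution s ->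
  exists i j, (i + j <= n)%N /\ has_type s i j.
Proof.
move=> sP; have [d sd] := involutive_solutionE S_nonempty sP.
have finS : finite_set [set: S] by apply/finite_setP; exists (2 ^ n * (2 * m + 1))%N.
have [x0] := dec_X_nonempty d.
have einj : injective (dec_bij d) := can_inj (splitbijTK (dec_bij d)).1.
have fin T (f : T -> dec_X d * dec_A d * dec_G d) : injective f -> finite_set [set: T].
  move=> finj; apply: card_le_finite finS; apply/card_leTP.
  by exists (dec_bij d \o f); exact: inj_comp.
have [k cX] : exists k, [set: dec_X d] #= `I_k.
  by apply/finite_setP/(fin _ (fun x => (x, 0, 1%g))) => x y [].
have [i cA] : exists i, [set: dec_A d] #= `I_(2 ^ i).
  apply: card_elementary_zmod; first exact: dec_A_elementary.
  by apply: (fin _ (fun a => (x0, a, 1%g))) => a b [].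
have [j cG] : exists j, [set: dec_G d] #= `I_(2 ^ j).
  apply: card_elementary_group; first exact: dec_G_elementary.
  by apply: (fin _ (fun g => (x0, 0, g))) => g h [].
have kE : (k * 2 ^ (i + j) = 2 ^ n * (2 * m + 1))%N.
  apply/card_eq_II; rewrite expnD mulnA.
  have := card_setXT (card_setXT cX cA) cG.
  rewrite card_eq_sym => /card_eq_trans; apply.
  apply: card_eq_trans _ cardS; apply/card_eqTP; exists (dec_bij d).
  by have [] := splitbijTK (dec_bij d); exists (dec_bij d)^-1%FUN.
(* [2 ^ (i + j)] divides [2 ^ n * (2 * m + 1)] and is coprime to the odd factor, so it divides
   [2 ^ n]. *)
have ijn : (i + j <= n)%N.
  rewrite -(@dvdn_Pexp2l 2)// -(@Gauss_dvdl _ _ (2 * m + 1)).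
    by rewrite -kE dvdn_mull.
  by rewrite coprimeXl// prime_coprime// dvdn_addr ?dvdn_mulr// dvdn1.
exists i, j; split=> //; exists d; split=> //.
rewrite (_ : (_ * _)%N = k)//; apply/eqP.
rewrite -(@eqn_pmul2r (2 ^ (i + j))) ?expn_gt0// kE.
by rewrite mulnAC -expnD subnK.
Qed.

Lemma card_iso_classes : iso_classes S #= `I_('C(n + 2, 2)).
Proof.
(* For each [i] from 0 to [n], the second exponent ranges over the [n.+1 - i] values from 0 to
   [n - i]. *)
pose P := {i : 'I_n.+1 & 'I_(n.+1 - i)}.
have leP (p : P) : (tag p + tagged p <= n)%N.
  case: p => i j /=; rewrite -ltnS addnC -ltn_subRL.
  by have := ltn_ord j; lia.
have /choice[s_ s_P] : forall p : P, exists s, has_type s (tag p) (tagged p).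
  by move=> p; exact/has_type_exists/leP.
have s_inv p : involutive_solution (s_ p).
  by have [d [-> _ _ _]] := s_P p; exact: solution_of_involutive.
have cl_inj : injective (fun p => iso_class (s_ p)).
  move=> p q pq; have [_ spq] : iso_class (s_ p) (s_ q).
    by rewrite pq; exact: iso_class_mem.
  have [] := has_type_inj (s_P p) (s_P q) spq.
  case: p q {pq spq} => [i j] [i' j'] /= /val_inj ii'.
  (* The type of [j'] depends on [i'], so the first components are identified before the second ones
     are compared. *)
  by case: i' / ii' j' => j' /val_inj ->.
have -> : iso_classes S = range (fun p => iso_class (s_ p)).
    apply/seteqP; split=> [_ [s sP <-]|_ [p _ <-]]; last by exists (s_ p); first exact: s_inv.
  have [i [j [ijn sij]]] := involutive_solution_has_type sP.
  have ltin : (i < n.+1)%N by lia.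
  have ltjn : (j < n.+1 - i)%N by lia.
  pose p : P := Tagged (fun i : 'I_n.+1 => 'I_(n.+1 - i))
    (Ordinal ltjn : 'I_(n.+1 - Ordinal ltin)).
  by exists p => //; apply: iso_class_eq; exact: has_type_isomorphic (s_P p) sij.
apply: card_eq_trans (inj_card_eq (in2W cl_inj)) _.
suff -> : 'C(n + 2, 2) = #|{: P}| by exact: card_finType.
(* The sum of the [n.+1 - i], in reverse order, is the sum of the integers below [n + 2] without its
   zero term. *)
rewrite card_tagged sumnE big_map big_enum /= -bin2_sum addn2.
rewrite big_nat_recl// add0n big_mkord (reindex_inj rev_ord_inj) /=.
by apply: eq_bigr => i _; rewrite card_ord; have := ltn_ord i; lia.
Qed.

End Count.

Theorem mainTheorem1 (S : Type) (S_nonempty : inhabited S) :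
  (* (i) *)
  (forall s : S * S -> S * S, involutive_solution s ->
    exists (A : zmodType) (G : groupType) (X : Type) (sigma : A -> Sym X)
           (e : {splitbij [set: X * A * G] >-> [set: S]}),
      [/\ elementary_abelian2_add A, elementary_abelian2_mul G, inhabited X
        & forall (x y : X) (a b : A) (g h : G),
            s (e (x, a, g), e (y, b, h)) =
            (e (x, a, (g * h)%g),
             e (sigma (a + b) ((sigma b)^-1%FUN y), a + b, h))])
  /\
  (* (ii) *)
  [/\ forall (d : decomposition S) (sigma : dec_A d -> Sym (dec_X d)),
        involutive_solution (solution_of sigma),
      forall s : S * S -> S * S, involutive_solution s ->
        exists (d : decomposition S) (sigma : dec_A d -> Sym (dec_X d)),
          s =1 solution_of sigma,
      forall (d1 d2 : decomposition S)
             (sigma1 : dec_A d1 -> Sym (dec_X d1))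
             (sigma2 : dec_A d2 -> Sym (dec_X d2)),
        isomorphic (solution_of sigma1) (solution_of sigma2) <->
        same_cardinalities d1 d2
    & classes_biject_with_decompositions S]
  /\
  (* (iii) *)
  (forall n m : nat, [set: S] #= `I_(2 ^ n * (2 * m + 1)) ->
    iso_classes S #= `I_('C(n + 2, 2))).
Proof.
split; [|split; [split|]].
- move=> s /(involutive_solutionE S_nonempty)[d ->].
  exists (dec_A d), (dec_G d), (dec_X d), (fun=> [splitbij of idfun]), (dec_bij d).
  split; [exact: dec_A_elementary|exact: dec_G_elementary|exact: dec_X_nonempty|].
  by move=> x y a b g h; rewrite /trivial_solution solution_ofE.
- exact: solution_of_involutive.
- move=> s /(involutive_solutionE S_nonempty)[d ->].
  by exists d, (fun=> [splitbij of idfun]).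
- exact: solution_of_isomorphicP.
- exact: classes_biject_with_decompositionsP.
- by move=> n m; exact: card_iso_classes.
Qed.
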